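(* Let $X$ be a normal projective algebraic variety over a field $k$, and let $\mathfrak{X}$ be its Riemann-Zariski space. Let $A$ be any subset of $\mathfrak{X}$. Then for any $\nu$ in the closure of $A$, either $\nu\in\overline{\{\mu\}}$ for some $\mu\in A$, or one can find a sequence of valuations $\nu_n\in A$ such that $\nu_n\to\nu$.
   Context: The field $k$ is not necessarily algebraically closed; varieties are irreducible and reduced. A valuation ring of the function field $k(X)$ is a subring $R\subset k(X)$ such that for every non-zero $x\in k(X)$, either $x\in R$ or $x^{-1}\in R$. Valuation rings of $k(X)$ containing $k$ are identified with (equivalence classes of) valuations $\nu$ on $k(X)$, trivial on $k$, with values in arbitrary totally ordered abelian groups, via $R_\nu=\{a:\ a=0\text{ or }\nu(a)\ge 0\}$. The Riemann-Zariski space $\mathfrak{X}$ of $X$ is the set of all valuation rings of $k(X)$ containing $k$, endowed with the topology having as a basis of open sets the sets $U(B)=\{R\in\mathfrak{X}:\ B\subset R\}$, where $B$ ranges over all subrings of $k(X)$ that contain $k$ and are finitely generated as $k$-algebras. (This space is in general not Hausdorff.) Closures and convergence are with respect to this topology. *)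

(* Defs.v *)
From HB Require Import structures.
From mathcomp Require Import all_boot all_order all_algebra.
From mathcomp Require Import mpoly.
From mathcomp Require Import boolp classical_sets functions topology.

Set Implicit Arguments.
Unset Strict Implicit.
Unset Printing Implicit Defensive.

Import GRing.Theory.

Local Open Scope classical_set_scope.
Local Open Scope ring_scope.
Local Open Scope quotient_scope.

(* The points of the scheme P^n_k are the homogeneous prime ideals of          *)
(* k[x_0, ..., x_n] that do not contain all of x_0, ..., x_n.  The library     *)
(* structure prime_idealr includes properness; that its carrier is boolean is  *)
(* no restriction, by the classical axioms of boolp.                           *)
Definition is_proj_point (k : fieldType) (n : nat)
    (P : prime_idealr {mpoly k[n.+1]}) : Prop :=
  (forall p d, p \in P -> pihomog mdeg d p \in P) /\
  (exists i : 'I_n.+1, 'X_i \notin P).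

(* Integral closed subschemes of P^n_k correspond to the points of P^n_k       *)
(* (their generic points): proj_ideal X is the homogeneous ideal of X.  This is *)
(* the irreducible, reduced, possibly not geometrically integral, notion.      *)
Record projVariety (k : fieldType) := ProjVariety {
  proj_dim : nat;
  proj_ideal : prime_idealr {mpoly k[proj_dim.+1]};
  proj_idealP : is_proj_point proj_ideal
}.

Section FunctionField.
Variables (k : fieldType) (X : projVariety k).

Local Notation n := (proj_dim X).
Local Notation S := {mpoly k[n.+1]}.

Definition coordRing : Type := {ideal_quot (proj_ideal X)}.

HB.instance Definition _ := GRing.ComNzRing.on coordRing.

Definition coord_unit : pred coordRing := fun x => `[< exists y, y * x = 1 >].
Definition coord_inv (x : coordRing) : coordRing :=
  match pselect (exists y, y * x = 1) with
  | left ex => projT1 (cid ex)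
  | right _ => x
  end.

Lemma coord_mulVr : {in coord_unit, left_inverse 1 coord_inv *%R}.
Proof.
move=> x; rewrite -topredE /= /coord_unit /coord_inv => /asboolP ex.
by case: pselect => // e; case: cid.
Qed.

Lemma coord_unitPl (x y : coordRing) : y * x = 1 -> coord_unit x.
Proof. by move=> yx; apply/asboolP; exists y. Qed.

Lemma coord_inv0id : {in [predC coord_unit], coord_inv =1 id}.
Proof.
move=> x; rewrite -topredE /= /coord_unit /coord_inv => /asboolPn ex.
by case: pselect.
Qed.

HB.instance Definition _ := GRing.ComNzRing_hasMulInverse.Build coordRing
  coord_mulVr coord_unitPl coord_inv0id.

Lemma coord_idomain : GRing.integral_domain_axiom coordRing.
Proof. exact: Quotient.rquot_IdomainAxiom. Qed.

HB.instance Definition _ :=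
  GRing.ComUnitRing_isIntegral.Build coordRing coord_idomain.

Definition to_coord (f : S) : coordRing := \pi_{ideal_quot (proj_ideal X)} f.

HB.instance Definition _ := GRing.RMorphism.copy to_coord
  (\pi_{ideal_quot (proj_ideal X)}).

Lemma to_coord_eq0 f : (to_coord f == 0) = (f \in proj_ideal X).
Proof.
rewrite -(rmorph0 to_coord) /to_coord; have := Quotient.idealrBE (proj_ideal X) f 0.
by rewrite subr0 => ->.
Qed.

Definition coord_frac (f g : S) : {fraction coordRing} :=
  tofrac (to_coord f) / tofrac (to_coord g).

(* k(X): the fractions f / g with f, g homogeneous of the same degree and g    *)
(* not vanishing identically on X.                                             *)
Definition function_field_pred : {pred {fraction coordRing}} :=
  fun a => `[< exists d (f g : S), [/\ f \is d.-homog, g \is d.-homog,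
     g \notin proj_ideal X & a = coord_frac f g] >].

Lemma function_field_closed : divring_closed function_field_pred.
Proof.
have nz g : g \notin proj_ideal X -> tofrac (to_coord g) != 0.
  by rewrite tofrac_eq0 to_coord_eq0.
have notinM g h : g \notin proj_ideal X -> h \notin proj_ideal X ->
    g * h \notin proj_ideal X.
  by move=> gP hP; rewrite prime_idealrM negb_or gP hP.
split.
- apply/asboolP; exists 0%N, 1, 1; split; rewrite ?dhomog1 ?idealr1 //.
  by rewrite /coord_frac rmorph1 tofrac1 divr1.
- move=> _ _ /asboolP[d [f [g [fd gd gP ->]]]] /asboolP[e [h [l [he le lP ->]]]].
  apply/asboolP; exists (d + e)%N, (f * l - g * h), (g * l).
  split; rewrite ?notinM ?dhomogM ?rpredB ?dhomogM //.
  rewrite /coord_frac rmorphB !rmorphM tofracB !tofracM /= -mulNr addf_div ?nz //.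
  by rewrite mulNr [_ * tofrac (to_coord g)]mulrC.
- move=> _ _ /asboolP[d [f [g [fd gd gP ->]]]] /asboolP[e [h [l [he le lP ->]]]].
  have [hP|hP] := boolP (h \in proj_ideal X); apply/asboolP.
    exists 0%N, 0, 1; split; rewrite ?dhomog1 ?idealr1 ?rpred0 //.
    have /eqP h0 : to_coord h == 0 by rewrite to_coord_eq0.
    by rewrite /coord_frac h0 !rmorph0 !mul0r invr0 mulr0.
  exists (d + e)%N, (f * l), (g * h); split; rewrite ?notinM ?dhomogM //.
  by rewrite /coord_frac !rmorphM /= invf_div mulf_div.
Qed.

HB.instance Definition _ := GRing.isDivringClosed.Build {fraction coordRing}
  function_field_pred function_field_closed.

Record functionField := FunctionField {
  ff_val : {fraction coordRing};
  ff_valP : ff_val \in function_field_pred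
}.

HB.instance Definition _ := [isSub for ff_val].
HB.instance Definition _ := [Choice of functionField by <:].
HB.instance Definition _ := [SubChoice_isSubComUnitRing of functionField by <:].
HB.instance Definition _ :=
  [SubComUnitRing_isSubIntegralDomain of functionField by <:].

Lemma ff_field : GRing.field_axiom functionField.
Proof.
move=> a; rewrite -(inj_eq val_inj) rmorph0 => a0; apply/unitrPr.
have aV : (val a)^-1 \in function_field_pred by rewrite rpredV; exact: ff_valP.
by exists (FunctionField aV); apply: val_inj; rewrite rmorphM rmorph1 mulfV.
Qed.

HB.instance Definition _ := GRing.UnitRing_isField.Build functionField ff_field.

Lemma const_subproof (c : k) :
  coord_frac c%:MP 1 \in function_field_pred.
Proof.
apply/asboolP; exists 0%N, c%:MP, 1; split=> //.
- by rewrite dhomogE msuppC; case: ifP => //=; rewrite mdeg0.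
- exact: dhomog1.
- by rewrite idealr1.
Qed.

Definition ff_const (c : k) : functionField := FunctionField (const_subproof c).

Lemma val_ff_const c : val (ff_const c) = tofrac (to_coord c%:MP).
Proof. by rewrite /= /coord_frac !rmorph1 divr1. Qed.

Lemma ff_const_is_zmod_morphism : zmod_morphism ff_const.
Proof.
move=> c d; apply: val_inj.
have valB (a b : functionField) : val (a - b) = val a - val b by exact: rmorphB.
by rewrite valB !val_ff_const mpolyCB !rmorphB.
Qed.

Lemma ff_const_is_monoid_morphism : monoid_morphism ff_const.
Proof.
split=> [|c d]; apply: val_inj.
  have val1 : val (1 : functionField) = 1 by exact: rmorph1.
  by rewrite val1 val_ff_const mpolyC1 !rmorph1.
have valM (a b : functionField) : val (a * b) = val a * val b by exact: rmorphM.
by rewrite valM !val_ff_const mpolyCM !rmorphM.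
Qed.

HB.instance Definition _ := GRing.isZmodMorphism.Build k functionField ff_const
  ff_const_is_zmod_morphism.
HB.instance Definition _ := GRing.isMonoidMorphism.Build k functionField ff_const
  ff_const_is_monoid_morphism.

(* For a point Q of P^n_k with proj_ideal X \subset Q, this is the local ring  *)
(* of X at Q.                                                                  *)
Definition local_ring (Q : prime_idealr S) : set functionField :=
  [set a | exists d (f g : S), [/\ f \is d.-homog, g \is d.-homog,
     g \notin Q & val a = coord_frac f g]].

Definition normal_variety : Prop :=
  forall Q : prime_idealr S, is_proj_point Q ->
    {subset proj_ideal X <= Q} ->
  forall (a : functionField) (p : {poly functionField}),
    p \is monic -> (forall i, local_ring Q p`_i) -> root p a -> local_ring Q a.

End FunctionField.

Section RiemannZariski.
Variables (k K : fieldType) (iota : {rmorphism k -> K}).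

Definition subring_over (B : set K) : Prop :=
  GRing.subring_closed (mem B) /\ range iota `<=` B.

Definition fg_subalgebra (B : set K) : Prop :=
  exists s : seq K, B = smallest subring_over [set` s].

(* The whole field is a valuation ring (of the trivial valuation).             *)
Record valuationRing := ValuationRing {
  vr_set :> set K;
  vr_subring : subring_over vr_set;
  vr_valuation : forall x, x != 0 -> vr_set x \/ vr_set x^-1
}.

HB.instance Definition _ := gen_eqMixin valuationRing.
HB.instance Definition _ := gen_choiceMixin valuationRing.

Definition rz_basic (B : set K) : set valuationRing := [set R | B `<=` vr_set R].

Lemma smallest_subring_over (G : set K) : subring_over (smallest subring_over G).
Proof.
split; last by move=> _ [c _ <-] M [[_ cM] _]; apply: cM; exists c.
split=> [|x y|x y]; rewrite ?inE.
- by move=> M [[[M1 _ _] _] _]; rewrite inE in M1.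
- move=> Bx By M MP; have [[[_ MB _] _] _] := MP.
  by have := MB x y; rewrite !inE; apply; [apply: Bx|apply: By].
- move=> Bx By M MP; have [[[_ _ MM] _] _] := MP.
  by have := MM x y; rewrite !inE; apply; [apply: Bx|apply: By].
Qed.

Lemma rz_cover : \bigcup_(B in fg_subalgebra) rz_basic B = setT.
Proof.
apply/seteqP; split=> // R _; exists (smallest subring_over [set` [::]]).
  by exists [::].
by apply: smallest_sub => //; exact: vr_subring.
Qed.

Lemma rz_join (B C : set K) (R : valuationRing) :
    fg_subalgebra B -> fg_subalgebra C -> rz_basic B R -> rz_basic C R ->
  exists D, [/\ fg_subalgebra D, rz_basic D R &
    rz_basic D `<=` rz_basic B `&` rz_basic C].
Proof.
move=> [s ->] [t ->] BR CR; exists (smallest subring_over [set` s ++ t]).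
split; first by exists (s ++ t).
  apply: smallest_sub; first exact: vr_subring.
  move=> x /=; rewrite mem_cat => /orP[xs|xt].
    by apply: BR; exact: sub_gen_smallest.
  by apply: CR; exact: sub_gen_smallest.
move=> R' DR'; split; apply: subset_trans DR';
  apply: smallest_sub (smallest_subring_over _) _ => x /= xs;
  by apply: sub_gen_smallest; rewrite /= mem_cat xs ?orbT.
Qed.

HB.instance Definition _ :=
  isBaseTopological.Build valuationRing rz_cover rz_join.

End RiemannZariski.

Definition riemannZariski (k : fieldType) (X : projVariety k) : topologicalType :=
  valuationRing (@ff_const k X).

(* Main.v *)
Require Import Defs.
From mathcomp Require Import all_boot all_order all_algebra.
From mathcomp Require Import mpoly.
From mathcomp Require Import boolp classical_sets functions topology.

(** Every point nu of the closure of A is the limit of a sequence in A. The reason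
    is that each element of K = k(X) is a quotient of two elements of one of
    countably many finite-dimensional k-subspaces V of K. Here V = V_d consists of the f / X_i^d
    with f homogeneous of degree d, where X_i does not vanish identically on X
    (functionField_fractions).

    A basic neighbourhood of nu imposes finitely many conditions of the form
    x in mu, with x in nu. Convergence asks for each of the possibly uncountably
    many x in nu that x be in nu_ n for n large, so a diagonal choice over the x is
    not available. What replaces it is linear algebra. For a valuation ring mu and
    q in K, the level of q at mu is the subspace of the u in V with u / q in mu.
    For a fixed mu the levels form a chain, so a level is known by its dimension
    and V has finitely many of them. Hence, given nu and finitely many valuation
    rings, the nonzero q in V fall into finitely many classes according to their
    levels at each of these rings, and finitely many elements of nu encode, class by
    class, what nu contains of the fractions with denominator q
    (finite_test_family). As nu is in the closure of A, the sequence can be built by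
    choosing in A a nu_ n that contains the finitely many elements so attached
    to V_0, ..., V_n and to nu, nu_ 0, ..., nu_ (n - 1) (closure_sequence).

    That an x = p / q in nu cannot fail to be in nu_ n infinitely often comes from
    the descending chain condition: the intersection of the levels of q at the
    nu_ n where x fails is an intersection of finitely many of them
    (bigcapv_stationary), and a representative of the class of q relative to those
    finitely many terms can stand in for q at all later ones. *)

Set Implicit Arguments.
Unset Strict Implicit.
Unset Printing Implicit Defensive.

Import GRing.Theory.

Local Open Scope classical_set_scope.

(** * Choice and finite-dimensional preliminaries *)

Lemma history_dependent_choice (T : Type) (P : seq T -> T -> Prop) :
  (forall s, exists y, P s y) ->
  exists f : nat -> T, forall n, P (mkseq f n) (f n).
Proof.
move=> /choice[F FP].
pose pre := fix pre n := if n is m.+1 then rcons (pre m) (F (pre m)) else [::].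
have preE n : mkseq (F \o pre) n = pre n.
  by elim: n => //= n IHn; rewrite mkseqS IHn.
by exists (F \o pre) => n; rewrite preE; exact: FP.
Qed.

Lemma finite_representatives (T : eqType) (I : finType) (c : T -> I)
    (P : T -> Prop) :
  exists r : seq T, (forall t, t \in r -> P t) /\
    (forall t, P t -> exists t', t' \in r /\ c t' = c t).
Proof.
have /choice[F FP] : forall i, exists o : option T,
    if o is Some t then P t /\ c t = i else forall t, P t -> c t <> i.
  move=> i; have [[t [Pt ct]]|noT] := pselect (exists t, P t /\ c t = i).
    by exists (Some t).
  by exists None => t Pt ct; apply: noT; exists t.
exists (pmap F (enum I)); split=> t.
  by rewrite mem_pmap => /mapP[i _ Fi]; have := FP i; rewrite -Fi => -[].
move=> Pt; have := FP (c t); case Fct: (F (c t)) => [t'|]; last by move=> /(_ t Pt).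
move=> [Pt' ct']; exists t'; split=> //.
by rewrite mem_pmap -Fct map_f ?mem_enum.
Qed.

Section Subspaces.
Variables (k : fieldType) (vT : vectType k).
Local Open Scope ring_scope.

(** A subspace of largest dimension among those contained in P exhausts P, as
    otherwise a vector of P outside it could be adjoined. *)
Lemma submodule_vspace (P : vT -> Prop) :
    P 0 -> (forall a u v, P u -> P v -> P (a *: u + v)) ->
  exists U : {vspace vT}, forall v, v \in U <-> P v.
Proof.
move=> P0 Plin.
pose Q m := `[< exists U : {vspace vT}, \dim U = m /\ forall v, v \in U -> P v >].
have Q0 : exists m, Q m.
  exists 0%N; apply/asboolP; exists 0%VS; rewrite dimv0; split=> // v.
  by rewrite memv0 => /eqP->.
have Qle m : Q m -> (m <= \dim {:vT})%N.
  by move=> /asboolP[U [<- _]]; rewrite dimvS ?subvf.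
have [_ /asboolP[U [<- UP]] Umax] := ex_maxnP Q0 Qle.
exists U => v; split=> [/UP //|Pv].
have QUv : Q (\dim (U + <[v]>)).
  apply/asboolP; exists (U + <[v]>)%VS; split=> // _ /memv_addP[u Uu [_ /vlineP[a ->] ->]].
  by rewrite addrC; apply: Plin => //; exact: UP.
have /eqP -> : (U == U + <[v]>)%VS by rewrite eqEdim addvSl Umax.
exact: (subvP (addvSr U _) _ (memv_line v)).
Qed.

(** The partial intersections decrease, hence are constant from the point N where
    their dimension is smallest. *)
Lemma bigcapv_stationary (I : pred nat) (W : nat -> {vspace vT}) :
  exists N, forall j, (N <= j)%N -> I j ->
    (\bigcap_(i < j | I i) W i <= W j)%VS.
Proof.
pose U j := (\bigcap_(i < j | I i) W i)%VS.
have Uanti i j : (i <= j)%N -> (U j <= U i)%VS.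
  move=> ij; apply/subv_bigcapP => l Il.
  exact: (bigcapv_inf (widen_ord ij l)).
have ex : exists m, `[< exists j, \dim (U j) = m >].
  by exists (\dim (U 0%N)); apply/asboolP; exists 0%N.
have [_ /asboolP[N <-] Nmin] := ex_minnP ex.
exists N => j Nj Ij.
have /eqP UE : (U j.+1 == U N)%VS.
  by rewrite eqEdim Uanti ?(leq_trans Nj) // Nmin //; apply/asboolP; exists j.+1.
apply: (subv_trans (Uanti _ _ Nj)); rewrite -UE.
exact: (bigcapv_inf (@ord_max j)).
Qed.

End Subspaces.

(** * Valuation rings and the topology of the Riemann-Zariski space *)

Section ValuationRings.
Variables (k K : fieldType) (iota : {rmorphism k -> K}).
Local Open Scope ring_scope.
Implicit Types (mu nu : valuationRing iota) (A : set (valuationRing iota)).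

Lemma valuationRingB mu x y : vr_set mu x -> vr_set mu y -> vr_set mu (x - y).
Proof. by have [[_ cB _] _] := vr_subring mu; move: (cB x y); rewrite !inE. Qed.

Lemma valuationRingM mu x y : vr_set mu x -> vr_set mu y -> vr_set mu (x * y).
Proof. by have [[_ _ cM] _] := vr_subring mu; move: (cM x y); rewrite !inE. Qed.

Lemma valuationRing_const mu c : vr_set mu (iota c).
Proof. by have [_] := vr_subring mu; apply; exists c. Qed.

Lemma valuationRing1 mu : vr_set mu 1.
Proof. by rewrite -(rmorph1 iota); exact: valuationRing_const. Qed.

Lemma valuationRing0 mu : vr_set mu 0.
Proof. by rewrite -(rmorph0 iota); exact: valuationRing_const. Qed.

Lemma valuationRingD mu x y : vr_set mu x -> vr_set mu y -> vr_set mu (x + y).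
Proof.
move=> mux muy; rewrite -[y]opprK -[- y]sub0r.
by do !apply: valuationRingB => //; exact: valuationRing0.
Qed.

Lemma valuationRing_div_trans mu (y x z : K) : y != 0 ->
  vr_set mu (x / y) -> vr_set mu (y / z) -> vr_set mu (x / z).
Proof.
by move=> y0 xy yz; have := valuationRingM xy yz; rewrite mulrA mulfVK.
Qed.

Lemma closure_finite_meet A nu (s : seq K) : closure A nu ->
  (forall x, x \in s -> vr_set nu x) ->
  exists mu, A mu /\ forall x, x \in s -> vr_set mu x.
Proof.
move=> Anu snu; pose B := smallest (subring_over iota) [set` s].
have [|mu [Amu Bmu]] := Anu (rz_basic B).
  apply: open_nbhs_nbhs; split.
    exists [set B]; first by move=> _ ->; exists s.
    by rewrite bigcup_set1.
  by apply: smallest_sub => //; exact: vr_subring.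
by exists mu; split=> // x xs; apply: Bmu; exact: sub_gen_smallest.
Qed.

Lemma valuationRing_cvg (nu_ : nat -> valuationRing iota) nu :
    (forall x, vr_set nu x -> exists N, forall n, (N <= n)%N -> vr_set (nu_ n) x) ->
  nu_ n @[n --> \oo] --> nu.
Proof.
move=> ev B; rewrite nbhsE => -[O [[D sD <-] [C DC Cnu]] DB].
have [s Cs] := sD _ DC.
have [N NP] : exists N, forall n, (N <= n)%N -> forall x, x \in s -> vr_set (nu_ n) x.
  have : forall x, x \in s -> vr_set nu x.
    by move=> x xs; apply: Cnu; rewrite Cs; exact: sub_gen_smallest.
  elim: (s) => [|x t IH] snu; first by exists 0%N.
  have [N1 N1P] := ev x (snu _ (mem_head _ _)).
  have [y yt|N2 N2P] := IH; first by apply: snu; rewrite inE yt orbT.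
  exists (maxn N1 N2) => n; rewrite geq_max => /andP[n1 n2] y.
  by rewrite inE => /orP[/eqP->|yt]; [exact: N1P|exact: N2P].
exists N => //= n /= Nn; apply: DB; exists C => //.
rewrite /rz_basic /= Cs; apply: smallest_sub; first exact: vr_subring.
by move=> x /= xs; exact: NP.
Qed.

(** * Levels of a valuation ring in a finite-dimensional space *)

Section Levels.
Variables (I : finType) (g : I -> K).
Local Notation V := 'rV[k]_#|I|.

Definition lincomb (u : V) : K := \sum_i iota (u 0 (enum_rank i)) * g i.

Lemma lincombP a u v : lincomb (a *: u + v) = iota a * lincomb u + lincomb v.
Proof.
rewrite /lincomb mulr_sumr -big_split /=; apply: eq_bigr => i _.
by rewrite !mxE rmorphD rmorphM mulrDl mulrA.
Qed.

Lemma lincomb0 : lincomb 0 = 0.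
Proof. by rewrite /lincomb big1 // => i _; rewrite mxE rmorph0 mul0r. Qed.

Lemma lincomb_surj (c : I -> k) :
  exists u, lincomb u = \sum_i iota (c i) * g i.
Proof.
exists (\row_j c (enum_val j)); apply: eq_bigr => i _.
by rewrite mxE enum_rankK.
Qed.

Lemma level_subproof mu q :
  exists U : {vspace V}, forall u, u \in U <-> vr_set mu (lincomb u / q).
Proof.
apply: submodule_vspace => [|a u v muu muv].
  by rewrite lincomb0 mul0r; exact: valuationRing0.
rewrite lincombP mulrDl -mulrA; apply: valuationRingD => //.
by apply: valuationRingM => //; exact: valuationRing_const.
Qed.

(** The elements of the span whose value at mu is at least that of q, pulled back
    to the coefficient vectors. The family g need not be independent. *)
Definition level mu q : {vspace V} := projT1 (cid (level_subproof mu q)).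

Lemma mem_level mu q u : u \in level mu q <-> vr_set mu (lincomb u / q).
Proof. by rewrite /level; case: cid. Qed.

Lemma mem_level_self mu u : lincomb u != 0 -> u \in level mu (lincomb u).
Proof. by move=> u0; apply/mem_level; rewrite divff //; exact: valuationRing1. Qed.

Lemma level_sub mu (p q : K) : p != 0 -> vr_set mu (p / q) -> (level mu p <= level mu q)%VS.
Proof.
move=> p0 pq; apply/subvP => u /mem_level up; apply/mem_level.
exact: valuationRing_div_trans pq.
Qed.

(** Of p / q and q / p one is in mu, so the two levels are comparable. *)
Lemma level_dim_inj mu (p q : K) : p != 0 -> q != 0 ->
  \dim (level mu p) = \dim (level mu q) -> level mu p = level mu q.
Proof.
move=> p0 q0 dpq.
have [pq|] := vr_valuation mu (mulf_neq0 p0 (invr_neq0 q0)).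
  by apply/eqP; rewrite eqEdim level_sub //= dpq.
rewrite invf_div => qp.
by apply/eqP; rewrite eq_sym eqEdim level_sub //= dpq.
Qed.

(** Whether mu contains the quotients p / q of the span V that lie in nu is
    tested on finitely many of them: the basis of a level of nu suffices for the
    numerators, and q' is a denominator that nu and the members of s cannot
    distinguish from q. *)
Definition passes_tests nu (s : seq (valuationRing iota)) mu : Prop :=
  forall q, lincomb q != 0 -> exists q', [/\ lincomb q' != 0,
    forall mu', mu' \in nu :: s -> level mu' (lincomb q') = level mu' (lincomb q) &
    forall b, b \in vbasis (level nu (lincomb q')) ->
      vr_set mu (lincomb b / lincomb q')].

(** A level is determined by its dimension, so the denominators q fall into
    finitely many classes, indexed by the dimensions of their levels at nu and at
    the members of s; one q' per class is enough. *)
Lemma finite_test_family nu (s : seq (valuationRing iota)) :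
  exists E : seq K, (forall x, x \in E -> vr_set nu x) /\
    forall mu, (forall x, x \in E -> vr_set mu x) -> passes_tests nu s mu.
Proof.
pose c (u : V) := [ffun i : 'I_(size (nu :: s)) =>
  inord (\dim (level (nth nu (nu :: s) i) (lincomb u))) : 'I_(#|I|).+1].
have [r [rP rc]] := finite_representatives c (fun u => lincomb u != 0).
exists (flatten [seq [seq lincomb b / lincomb q | b <- vbasis (level nu (lincomb q))]
               | q <- r]).
split=> [x /flatten_mapP[q _ /mapP[b bq ->]]|mu muE q q0].
  by apply/mem_level; exact: vbasis_mem bq.
have [q' [q'r cq']] := rc q q0; have q'0 := rP _ q'r.
exists q'; split=> // [mu' mu's|b bq'].
  apply: level_dim_inj => //.
  have imu : (index mu' (nu :: s) < size (nu :: s))%N by rewrite index_mem.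
  have /(congr1 val) := congr1 (fun f : {ffun _ -> _} => f (Ordinal imu)) cq'.
  have dimle U : (\dim (U : {vspace V}) < (#|I|).+1)%N.
    by rewrite ltnS (leq_trans (dimvS (subvf U))) // dimvf /dim /= mul1n.
  by rewrite !ffunE /= !inordK // nth_index.
by apply: muE; apply/flatten_mapP; exists q' => //; exact: map_f.
Qed.

End Levels.

(** The n-th term of the sequence is taken in A so that it passes, in each of the
    spans number 0, ..., n, the tests relative to all the terms before it.

    Suppose that x = p / q in nu lies outside nu_ j for all j in an infinite set J,
    and let W j be the level of q at nu_ j. By stationarity the intersection of the
    W i, for i < j in J, is contained in W j once j is large; choose such a j in J.
    The tests of nu_ j provide a q' with the levels of q at the earlier terms, so
    q' lies in each earlier W i, hence in W j: thus q' / q is in nu_ j. Also p lies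
    in the level of q at nu, which is that of q', and so p / q' is in nu_ j by the
    tests. Then p / q is in nu_ j, a contradiction. *)
Lemma closure_sequence (I : nat -> finType) (g : forall d, I d -> K) A nu :
    (forall x, exists d (p q : 'rV[k]_#|I d|),
       lincomb (g d) q != 0 /\ x = lincomb (g d) p / lincomb (g d) q) ->
    closure A nu ->
  exists2 nu_ : nat -> valuationRing iota,
    (forall n, A (nu_ n)) & nu_ n @[n --> \oo] --> nu.
Proof.
move=> gK Anu.
pose P s mu := A mu /\ forall d, (d <= size s)%N -> passes_tests (g d) nu s mu.
have [s|nu_ nuP] := @history_dependent_choice _ P.
  have /choice[E EP] d := finite_test_family (g d) nu s.
  have [|mu [Amu muE]] :=
      @closure_finite_meet A nu (flatten [seq E d | d <- seq.iota 0 (size s).+1]) Anu.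
    by move=> x /flatten_mapP[d _ xE]; exact: (EP d).1.
  exists mu; split=> // d ds; apply: (EP d).2 => x xE.
  by apply: muE; apply/flatten_mapP; exists d => //; rewrite mem_iota.
exists nu_ => [n|]; first by have [] := nuP n.
apply: valuationRing_cvg => x nux; apply: contrapT => fails.
have {}fails N : exists n, (N <= n)%N /\ ~ vr_set (nu_ n) x.
  apply: contrapT => noN; apply: fails; exists N => n Nn.
  by apply: contrapT => nx; apply: noN; exists n.
have [d [p [q [q0 xE]]]] := gK x.
pose J n := `[< ~ vr_set (nu_ n) x >]; pose W n := level (g d) (nu_ n) (lincomb (g d) q).
have [N NP] := bigcapv_stationary J W.
have [j [Nj jx]] := fails (maxn N d); have Jj : J j by exact/asboolP.
have [{}Nj dj] : (N <= j /\ d <= j)%N by apply/andP; rewrite -geq_max.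
have [_] := nuP j; rewrite size_mkseq => /(_ d dj q q0) [q' [q'0 q'q q'nu]].
have q'Wj : q' \in W j.
  rewrite memvE; apply: (subv_trans _ (NP j Nj Jj)).
  apply/subv_bigcapP => i _; rewrite -memvE /W -(q'q (nu_ i)).
    exact: mem_level_self.
  by rewrite in_cons map_f ?orbT // mem_iota add0n ltn_ord.
have nu_nu_j : (level (g d) nu (lincomb (g d) q') <=
    level (g d) (nu_ j) (lincomb (g d) q'))%VS.
  rewrite -(span_basis (vbasisP (level (g d) nu _))).
  by apply/span_subvP => b bq'; apply/mem_level; exact: q'nu.
apply: jx; rewrite xE; apply: (valuationRing_div_trans q'0); last exact/mem_level.
apply/mem_level/(subvP nu_nu_j); rewrite q'q ?mem_head //.
by apply/mem_level; rewrite -xE.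
Qed.

End ValuationRings.

(** * The function field as fractions of finite-dimensional spaces *)

Section FunctionFieldFractions.
Variables (k : fieldType) (X : projVariety k).
Local Open Scope ring_scope.

Local Notation bounded_monom d := 'X_{1..(proj_dim X).+1 < d.+1}.

(** The bounded monomials include those of degree less than d, for which the
    fraction is not homogeneous of degree 0 and the default value 0 is taken; they do
    not occur in forms of degree d. *)
Definition monom_frac (i : 'I_(proj_dim X).+1) (d : nat) (m : bounded_monom d) :
    functionField X :=
  insubd 0 (@coord_frac k X 'X_[m] ('X_i ^+ d)).

Lemma expX_notin_ideal i d :
  'X_i \notin proj_ideal X -> 'X_i ^+ d \notin proj_ideal X.
Proof.
move=> iX; elim: d => [|d IHd]; first by rewrite expr0 idealr1.
by rewrite exprS prime_idealrM negb_or iX.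
Qed.

Lemma coord_frac_lincomb i d (f : {mpoly k[(proj_dim X).+1]}) :
  'X_i \notin proj_ideal X -> f \is d.-homog ->
  exists u, val (lincomb (@ff_const k X) (@monom_frac i d) u) =
    @coord_frac k X f ('X_i ^+ d).
Proof.
move=> iX fd.
have [u uE] := lincomb_surj (@ff_const k X) (@monom_frac i d)
  (fun m : bounded_monom d => f@_m).
exists u; rewrite uE raddf_sum /=.
have term (m : bounded_monom d) : val (ff_const X f@_m) * val (monom_frac i m) =
    @coord_frac k X (f@_m *: 'X_[m]) ('X_i ^+ d).
  have [fm0|fm0] := eqVneq f@_m 0.
    by rewrite fm0 scale0r rmorph0 /coord_frac !rmorph0 !mul0r.
  have md : mdeg m = d by apply: (dhomogP _ _ _ fd); rewrite mcoeff_msupp.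
  rewrite val_ff_const /monom_frac insubdK.
    by rewrite /coord_frac mulrA -tofracM -rmorphM mul_mpolyC.
  apply/asboolP; exists d, 'X_[m], ('X_i ^+ d); split=> //.
  - by rewrite dhomogX; apply/eqP.
  - by rewrite -[d in d.-homog]mul1n dhomogMn // dhomogX; apply/eqP/mdeg1.
  - exact: expX_notin_ideal.
rewrite (eq_bigr _ (fun m _ => term m)) /coord_frac -mulr_suml.
congr (_ / _).
transitivity (tofrac (@to_coord k X (\sum_(m : bounded_monom d) f@_m *: 'X_[m]))).
  by rewrite !rmorph_sum.
congr (tofrac (@to_coord k X _)); rewrite -mpolywE //.
rewrite mmeasureE; apply/bigmax_leqP_seq => m mf _.
by rewrite ltnS (dhomogP _ _ _ fd).
Qed.

Lemma functionField_fractions i : 'X_i \notin proj_ideal X ->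
  forall x : functionField X, exists d p q,
    lincomb (@ff_const k X) (@monom_frac i d) q != 0 /\
    x = lincomb (@ff_const k X) (@monom_frac i d) p /
        lincomb (@ff_const k X) (@monom_frac i d) q.
Proof.
move=> iX x; have /asboolP[d [f [h [fd hd hX xE]]]] := ff_valP x.
have [p pE] := coord_frac_lincomb iX fd; have [q qE] := coord_frac_lincomb iX hd.
have nz r : r \notin proj_ideal X -> tofrac (@to_coord k X r) != 0.
  by rewrite tofrac_eq0 to_coord_eq0.
have X0 := nz _ (expX_notin_ideal d iX).
exists d, p, q; split.
  apply: contraNneq (mulf_neq0 (nz _ hX) (invr_neq0 X0)) => q0.
  by rewrite -[X in X == 0]qE q0 rmorph0.
apply: val_inj; rewrite fmorph_div /= pE qE xE /coord_frac invf_div mulf_div.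
by rewrite [_ * tofrac (to_coord h)]mulrC -mulf_div divff // mulr1.
Qed.

End FunctionFieldFractions.

Theorem theorem3p1 (k : fieldType) (X : projVariety k) (X_normal : normal_variety X)
    (A : set (riemannZariski X)) (nu : riemannZariski X) (A_nu : closure A nu) :
  (exists2 mu, A mu & closure [set mu] nu) \/
  (exists2 nu_ : nat -> riemannZariski X,
     (forall n, A (nu_ n)) & nu_ n @[n --> \oo] --> nu).
Proof.
right; have [_ [i iX]] := proj_idealP X.
exact: (closure_sequence (functionField_fractions iX) A_nu).
Qed.
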